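(* Let $G$ be a group and $\mathcal{C}_G^\times$ a $G$-crossed braided tensor category extending a unitary modular tensor category $\mathcal{C}_{\mathbf 0}$, such that $G$ does not permute the anyons. Let $\mathbf g\in G$ and $n\ge1$ with $\mathbf g^n=\mathbf 0$ (the identity), let $0_{\mathbf g}$ be an Abelian $\mathbf g$-defect, and let $f=(0_{\mathbf g})^{n}\in\mathcal{A}$ be the Abelian anyon obtained by fusing $n$ copies of $0_{\mathbf g}$. Define $$\mathcal{I}_n(0_{\mathbf g})=\theta_{0_{\mathbf g}}^n\prod_{j=0}^{n-1}\eta_{0_{\mathbf g}}(\mathbf g,\mathbf g^j).$$ Then $\mathcal{I}_n(0_{\mathbf g})$ is invariant under vertex basis and symmetry action gauge transformations, and $$\mathcal{I}_n(0_{\mathbf g})^{2n}=\theta_f^2=M_{f,f}.$$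
   Context: $\mathcal{C}_{\mathbf 0}$ is a unitary modular tensor category (its simple objects are ''anyons''); $\mathcal{A}$ is the finite Abelian group of Abelian (quantum dimension 1) anyons under fusion; for $b\in\mathcal{A}$ and any anyon $a$, $M_{a,b}=R^{a,b}R^{b,a}$; $\theta_a$ is the topological twist ($\theta_a=R^{a,a}$ for Abelian anyons and Abelian defects $a$). $\mathbf 0$ denotes the identity of $G$, $\bar{\mathbf g}=\mathbf g^{-1}$. A $G$-crossed braided tensor category (BTC) $\mathcal{C}_G^\times=\bigoplus_{\mathbf g\in G}\mathcal{C}_{\mathbf g}$ is a $G$-graded unitary fusion-type category with trivial component $\mathcal{C}_{\mathbf 0}$, a $G$-action $x\mapsto{}^{\mathbf k}x$ mapping $\mathcal{C}_{\mathbf g}\to\mathcal{C}_{\mathbf{kgk}^{-1}}$, and a $G$-crossed braiding ($c_{\mathbf k}\times a_{\mathbf g}={}^{\mathbf k}a_{\mathbf g}\times c_{\mathbf k}$). Simple objects of $\mathcal{C}_{\mathbf g}$ are called $\mathbf g$-defects; a defect is Abelian if it has quantum dimension 1. Skeletally it is given by data $\{F,R,U,\eta\}$: $F$-symbols satisfying the pentagon equation; $G$-crossed $R$-symbols; phases/matrices $U_{\mathbf k}(a,b;c)$ for the action of $\mathbf k$ on splitting spaces; phases $\eta_x(\mathbf g,\mathbf h)$ relating the action of $\mathbf{gh}$ to the composition of the actions, with $U_{\mathbf 0}=1$, $\eta_0=1$, $\eta_x(\mathbf g,\mathbf 0)=\eta_x(\mathbf 0,\mathbf h)=1$. For Abelian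 objects subscripts are dropped, and for $a\in\mathcal{C}_{\mathbf g},b\in\mathcal{C}_{\mathbf h},c\in\mathcal{C}_{\mathbf k}$ the consistency equations read $R^{a,c}F^{a,c,{}^{\bar{\mathbf k}}b}R^{b,c}=F^{c,{}^{\bar{\mathbf k}}a,{}^{\bar{\mathbf k}}b}\,U_{\mathbf k}(a,b)\,R^{ab,c}F^{a,b,c}$, $(R^{c,a})^{-1}F^{a,{}^{\bar{\mathbf g}}c,b}(R^{{}^{\bar{\mathbf g}}c,b})^{-1}=F^{c,a,b}\,\eta_c(\mathbf g,\mathbf h)\,(R^{c,ab})^{-1}F^{a,b,{}^{\bar{\mathbf h}\bar{\mathbf g}}c}$, $\eta_x(\mathbf g,\mathbf h)\eta_x(\mathbf{gh},\mathbf k)=\eta_{{}^{\bar{\mathbf g}}x}(\mathbf h,\mathbf k)\eta_x(\mathbf g,\mathbf{hk})$, $\eta_a(\mathbf k,\mathbf l)\eta_b(\mathbf k,\mathbf l)U_{\mathbf l}({}^{\bar{\mathbf k}}a,{}^{\bar{\mathbf k}}b)U_{\mathbf k}(a,b)=U_{\mathbf{kl}}(a,b)\eta_{ab}(\mathbf k,\mathbf l)$, and the $G$-crossed ribbon property $R^{b,{}^{\bar{\mathbf h}}a}R^{a,b}=\frac{\theta_{ab}}{\theta_a\theta_b}\frac{U_{\mathbf{gh}}(a,b)}{\eta_a(\mathbf g,\mathbf h)\eta_b(\mathbf h,\bar{\mathbf h}\mathbf{gh})}$. Since $G$ acts trivially on anyons, each $\mathcal{C}_{\mathbf g}$ contains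 an Abelian defect, and once one, $0_{\mathbf g}$, is chosen for each $\mathbf g$ ($0_{\mathbf 0}$ trivial), $0_{\mathbf g}\times0_{\mathbf h}=\mathfrak{w}(\mathbf g,\mathbf h)\times0_{\mathbf{gh}}$ with $\mathfrak{w}$ an $\mathcal{A}$-valued 2-cocycle. Gauge transformations. Vertex basis (phases $\Gamma^{a,b}$, with $\Gamma^{a,0}=\Gamma^{0,b}=\Gamma^{0,0}$): $R^{a,b}\to\Gamma^{b,{}^{\bar{\mathbf h}}a}R^{a,b}(\Gamma^{a,b})^{-1}$ for $b\in\mathcal{C}_{\mathbf h}$, $\eta$ unchanged. Symmetry action (phases $\gamma_a(\mathbf k)$, with $\gamma_0(\mathbf k)=\gamma_a(\mathbf 0)=1$): $R^{a,b}\to\gamma_a(\mathbf h)R^{a,b}$ for $b\in\mathcal{C}_{\mathbf h}$, $\eta_x(\mathbf g,\mathbf h)\to\frac{\gamma_x(\mathbf{gh})}{\gamma_x(\mathbf g)\gamma_{{}^{\bar{\mathbf g}}x}(\mathbf h)}\eta_x(\mathbf g,\mathbf h)$. *)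

(* Defs.v *)
(* Skeletal G-crossed braided tensor categories (MathComp).                   *)
(*                                                                            *)
(* Conventions.  [obj] is the set of (isomorphism classes of) simple objects, *)
(* i.e. defects.  A basis of each splitting space V^{ab}_c is fixed, of size  *)
(* [N a b c].  Entries of the F-, R- and U-symbols are addressed by natural   *)
(* numbers, and only the entries whose vertex indices lie below the relevant  *)
(* multiplicities are ever read.  This is because the multiplicities of       *)
(* V^{ab}_c and V^{b,^{h^-1}a}_c, or of V^{ab}_c and V^{^k a ^k b}_{^k c},     *)
(* agree by an axiom but not by computation.                                  *)
From mathcomp Require Import all_boot all_order all_algebra.

Set Implicit Arguments.
Unset Strict Implicit.
Unset Printing Implicit Defensive.

Import Order.TTheory GRing.Theory Num.Theory.
Local Open Scope ring_scope.

(* [sector g] enumerates the simple objects of C_g; G itself may be infinite. *)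
Record defect_fusion (G : groupType) := DefectFusion {
  obj : eqType;
  deg : obj -> G;
  sector : G -> seq obj;
  vac : obj;
  dual : obj -> obj;
  N : obj -> obj -> obj -> nat;
  act : G -> obj -> obj
}.
Arguments vac {G d}.

Section Fusion.
Context {G : groupType} {D : defect_fusion G}.
Implicit Types (g h k : G) (a b c d e : obj D).

(* The objects that can occur in the decomposition of a x b. *)
Definition chan a b : seq (obj D) := sector D (deg a * deg b)%g.

Record fusion_axioms : Prop := FusionAxioms {
  sector_uniq : forall g, uniq (sector D g);
  mem_sector : forall g a, (a \in sector D g) = (deg a == g);
  sector_neq0 : forall g, sector D g != [::];
  deg_vac : deg (vac : obj D) = 1%g;
  deg_fusion : forall a b c, (0 < N a b c)%N -> deg c = (deg a * deg b)%g;
  vac_fusionl : forall a b, N vac a b = (a == b) :> nat;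
  vac_fusionr : forall a b, N a vac b = (a == b) :> nat;
  dual_fusionl : forall a b, N a b vac = (b == dual a) :> nat;
  dual_fusionr : forall a b, N b a vac = (b == dual a) :> nat;
  fusion_assoc : forall a b c d,
    (\sum_(e <- chan a b) N a b e * N e c d =
     \sum_(f <- chan b c) N b c f * N a f d)%N;
  act1 : forall a, act 1%g a = a;
  actM : forall k l a, act (k * l)%g a = act k (act l a);
  deg_act : forall k a, deg (act k a) = (k * deg a * k^-1)%g;
  act_vac : forall k, act k (vac : obj D) = vac;
  act_fusion : forall k a b c, N (act k a) (act k b) (act k c) = N a b c;
  crossed_fusion : forall a b c, N a b c = N b (act (deg b)^-1 a) c
}.

(* The product of a and b when a x b is simple; [vac] is a mere default. *)
Definition fuse a b : obj D :=
  head vac [seq c <- chan a b | (0 < N a b c)%N].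

Definition fuse_pow a n : obj D := iter n (fun x => fuse x a) vac.

End Fusion.

Arguments fusion_axioms {G} D.

(* [F a b c d e al be f mu nu] is [F^{abc}_d]_{(e,al,be)(f,mu,nu)}, where     *)
(*   |a,b;e,al>|e,c;d,be> = sum_{f,mu,nu} F |b,c;f,mu>|a,f;d,nu>.             *)
(* [R a b c mu nu] is [R^{ab}_c]_{mu nu}, from V^{b,^{h^-1}a}_c (index mu) to *)
(* V^{ab}_c (index nu), for b in C_h.                                         *)
(* [U k a b c mu nu] is [U_k(a,b;c)]_{mu nu}, where k maps the mu-th vertex of *)
(* V^{^{k^-1}a,^{k^-1}b}_{^{k^-1}c} to sum_nu U |a,b;c,nu>.                    *)
Record symbols (C : Type) (G : groupType) (D : defect_fusion G) := Symbols {
  F : obj D -> obj D -> obj D -> obj D ->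
      obj D -> nat -> nat -> obj D -> nat -> nat -> C;
  R : obj D -> obj D -> obj D -> nat -> nat -> C;
  U : G -> obj D -> obj D -> obj D -> nat -> nat -> C;
  eta : obj D -> G -> G -> C
}.

Section Crossed.
Context {C : numClosedFieldType} {G : groupType} {D : defect_fusion G}.
Implicit Types (S : symbols C D) (g h k : G) (a b c d e f : obj D).

Definition phase (z : C) : Prop := `|z| = 1.

(* The leading n x n block of M is unitary. *)
Definition unitary_block (n : nat) (M : nat -> nat -> C) : Prop :=
  (\matrix_(i < n, j < n) M i j) \is unitarymx.

(* Quantum dimension: d_a = |[F^{a abar a}_a]_{00}|^-1. *)
Definition qdim S a : C :=
  `|F S a (dual a) a a vac 0 0 vac 0 0|^-1.

Definition abelian S a : Prop := qdim S a = 1.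

(* Topological twist: theta_a = sum_{c,mu} (d_c / d_a) [R^{aa}_c]_{mu mu};    *)
(* for a of degree g this is a trace because ^g a = a.                        *)
Definition twist S a : C :=
  \sum_(c <- chan a a) \sum_(mu < N a a c)
    qdim S c / qdim S a * R S a a c mu mu.

Record F_axioms S : Prop := FAxioms {
  F_unitaryl : forall a b c d,
    forall e e', e \in chan a b -> e' \in chan a b ->
    forall (al : 'I_(N a b e)) (be : 'I_(N e c d))
           (al' : 'I_(N a b e')) (be' : 'I_(N e' c d)),
    \sum_(f <- chan b c) \sum_(mu < N b c f) \sum_(nu < N a f d)
      F S a b c d e al be f mu nu * (F S a b c d e' al' be' f mu nu)^*
    = [&& e == e', al == al' :> nat & be == be' :> nat]%:R;
  F_unitaryr : forall a b c d,
    forall f f', f \in chan b c -> f' \in chan b c ->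
    forall (mu : 'I_(N b c f)) (nu : 'I_(N a f d))
           (mu' : 'I_(N b c f')) (nu' : 'I_(N a f' d)),
    \sum_(e <- chan a b) \sum_(al < N a b e) \sum_(be < N e c d)
      (F S a b c d e al be f mu nu)^* * F S a b c d e al be f' mu' nu'
    = [&& f == f', mu == mu' :> nat & nu == nu' :> nat]%:R;
  F_vac1 : forall b c d (be mu : 'I_(N b c d)),
    F S vac b c d b 0 be d mu 0 = (be == mu)%:R;
  F_vac2 : forall a c d (be nu : 'I_(N a c d)),
    F S a vac c d a 0 be c 0 nu = (be == nu)%:R;
  F_vac3 : forall a b d (al nu : 'I_(N a b d)),
    F S a b vac d d al 0 b 0 nu = (al == nu)%:R;
  F_pentagon : forall a b c d e (f g l k : obj D)
    (al : 'I_(N a b f)) (be : 'I_(N f c g)) (ga : 'I_(N g d e))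
    (nu : 'I_(N c d l)) (la : 'I_(N b l k)) (mu : 'I_(N a k e)),
    \sum_(de < N f l e)
      F S f c d e g be ga l nu de * F S a b l e f al de k la mu
    = \sum_(h <- chan b c)
      \sum_(si < N b c h) \sum_(ps < N a h g) \sum_(ta < N h d k)
        F S a b c g f al be h si ps * F S a h d e g ps ga k ta mu
          * F S b c d k h si ta l nu la;
  F_rigid : forall a, F S a (dual a) a a vac 0 0 vac 0 0 != 0;
  qdim_dual : forall a, qdim S (dual a) = qdim S a;
  qdim_fusion : forall a b,
    qdim S a * qdim S b = \sum_(c <- chan a b) (N a b c)%:R * qdim S c
}.

Record action_axioms S : Prop := ActionAxioms {
  U_unitary : forall k a b c, unitary_block (N a b c) (U S k a b c);
  U_1 : forall a b c (mu nu : 'I_(N a b c)),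
    U S 1%g a b c mu nu = (mu == nu)%:R;
  U_vacr : forall k a, U S k a vac a 0 0 = 1;
  U_vacl : forall k b, U S k vac b b 0 0 = 1;
  eta_phase : forall x g h, phase (eta S x g h);
  eta_vac : forall g h, eta S vac g h = 1;
  eta_1r : forall x g, eta S x g 1%g = 1;
  eta_1l : forall x h, eta S x 1%g h = 1;
  U_F : forall k a b c d e f,
    let k' := act k^-1 in
    forall (al : 'I_(N (k' a) (k' b) (k' e))) (be : 'I_(N (k' e) (k' c) (k' d)))
           (mu : 'I_(N b c f)) (nu : 'I_(N a f d)),
    \sum_(al' < N a b e) \sum_(be' < N e c d)
      U S k a b e al al' * U S k e c d be be' * F S a b c d e al' be' f mu nu
    = \sum_(mu' < N (k' b) (k' c) (k' f)) \sum_(nu' < N (k' a) (k' f) (k' d))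
      F S (k' a) (k' b) (k' c) (k' d) (k' e) al be (k' f) mu' nu'
        * U S k b c f mu' mu * U S k a f d nu' nu;
  U_eta : forall k l a b c (mu nu : 'I_(N a b c)),
    let k' := act k^-1 in
    eta S a k l * eta S b k l *
      \sum_(la < N (k' a) (k' b) (k' c))
        U S l (k' a) (k' b) (k' c) mu la * U S k a b c la nu
    = U S (k * l)%g a b c mu nu * eta S c k l;
  eta_cocycle : forall x g h k,
    eta S x g h * eta S x (g * h)%g k
    = eta S (act g^-1 x) h k * eta S x g (h * k)%g
}.

(* By unitarity, (R^-1)_{mu nu} is the conjugate of R_{nu mu}. *)
Record crossing_axioms S : Prop := CrossingAxioms {
  R_unitary : forall a b c, unitary_block (N a b c) (R S a b c);
  heptagon1 : forall a b c d e (g : obj D),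
    let k' := act (deg c)^-1 in
    forall (al : 'I_(N c (k' a) e)) (be : 'I_(N e (k' b) d))
           (mu : 'I_(N b c g)) (nu : 'I_(N a g d)),
    \sum_(la < N a c e) \sum_(ga < N c (k' b) g)
      R S a c e al la * F S a c (k' b) d e la be g ga nu * R S b c g ga mu
    = \sum_(f <- chan a b)
      \sum_(de < N (k' a) (k' b) (k' f)) \sum_(si < N c (k' f) d)
      \sum_(ep < N a b f) \sum_(ps < N f c d)
        F S c (k' a) (k' b) d e al be (k' f) de si * U S (deg c) a b f de ep
          * R S f c d si ps * F S a b c d f ep ps g mu nu;
  heptagon2 : forall a b c d e (k : obj D),
    let c1 := act (deg a)^-1 c in
    let c2 := act (deg b)^-1 c1 in
    forall (al : 'I_(N c a e)) (be : 'I_(N e b d))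
           (mu : 'I_(N b c2 k)) (nu : 'I_(N a k d)),
    \sum_(la < N a c1 e) \sum_(ga < N c1 b k)
      (R S c a e la al)^* * F S a c1 b d e la be k ga nu
        * (R S c1 b k mu ga)^*
    = \sum_(f <- chan a b)
      \sum_(de < N a b f) \sum_(si < N c f d) \sum_(ps < N f c2 d)
        F S c a b d e al be f de si * eta S c (deg a) (deg b)
          * (R S c f d ps si)^* * F S a b c2 d f de ps k mu nu;
  crossed_ribbon : forall a b c (mu nu : 'I_(N a b c)),
    let g := deg a in let h := deg b in let a' := act h^-1 a in
    \sum_(la < N b a' c) R S b a' c mu la * R S a b c la nu
    = twist S c / (twist S a * twist S b)
      * (U S (g * h)%g a b c mu nu
         / (eta S a g h * eta S b h (h^-1 * g * h)%g))
}.

(* S = (C, D) is a G-crossed braided tensor category (possibly with a         *)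
(* degenerate trivial sector).                                                *)
Record crossed_btc S : Prop := CrossedBTC {
  crossed_fusion_axioms : fusion_axioms D;
  crossed_F_axioms : F_axioms S;
  crossed_action_axioms : action_axioms S;
  crossed_crossing_axioms : crossing_axioms S
}.

(* Modularity of the (unitary ribbon fusion) category C_0: its S-matrix,      *)
(* S_{ab} = sum_c N_{a bbar}^c theta_c / (theta_a theta_b) d_c up to the      *)
(* positive factor 1/dim, is nondegenerate.                                   *)
Definition smatrix_entry S a b : C :=
  \sum_(c <- chan a (dual b))
    (N a (dual b) c)%:R * (twist S c / (twist S a * twist S b)) * qdim S c.

Definition modular_trivial_sector S : Prop :=
  let s := sector D 1%g in
  \matrix_(i < size s, j < size s)
    smatrix_entry S (nth vac s i) (nth vac s j) \in unitmx.

(* R^{a,b} for a x b simple. *)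
Definition Rab S a b : C := R S a b (fuse a b) 0 0.

Definition monodromy S a b : C := Rab S a b * Rab S b a.

(* Vertex basis transformations |a,b;c,mu> -> sum_mu' Gamma_{mu mu'}          *)
(* |a,b;c,mu'>, normalized by Gamma^{a,0} = Gamma^{0,b} = Gamma^{0,0}.        *)
Record vertex_gauge (Ga : obj D -> obj D -> obj D -> nat -> nat -> C) : Prop :=
  VertexGauge {
  vertex_gauge_unitary : forall a b c, unitary_block (N a b c) (Ga a b c);
  vertex_gauge_vacr : forall a, Ga a vac a 0%N 0%N = Ga vac vac vac 0%N 0%N;
  vertex_gauge_vacl : forall b, Ga vac b b 0%N 0%N = Ga vac vac vac 0%N 0%N
}.

Definition vertex_transform
    (Ga : obj D -> obj D -> obj D -> nat -> nat -> C) S : symbols C D :=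
  {| F := fun a b c d e al be f mu nu =>
       \sum_(al' < N a b e) \sum_(be' < N e c d)
       \sum_(mu' < N b c f) \sum_(nu' < N a f d)
         Ga a b e al al' * Ga e c d be be' * F S a b c d e al' be' f mu' nu'
           * (Ga b c f mu mu')^* * (Ga a f d nu nu')^*;
     R := fun a b c mu nu =>
       let a' := act (deg b)^-1 a in
       \sum_(mu' < N b a' c) \sum_(nu' < N a b c)
         Ga b a' c mu mu' * R S a b c mu' nu' * (Ga a b c nu nu')^*;
     U := fun k a b c mu nu =>
       let k' := act k^-1 in
       \sum_(mu' < N (k' a) (k' b) (k' c)) \sum_(nu' < N a b c)
         Ga (k' a) (k' b) (k' c) mu mu' * U S k a b c mu' nu'
           * (Ga a b c nu nu')^*;
     eta := eta S |}.

(* Symmetry action transformations, gamma_a(k) = [ga a k]. *)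
Record symmetry_gauge (ga : obj D -> G -> C) : Prop := SymmetryGauge {
  symmetry_gauge_phase : forall a k, phase (ga a k);
  symmetry_gauge_vac : forall k, ga vac k = 1;
  symmetry_gauge_1 : forall a, ga a 1%g = 1
}.

Definition symmetry_transform (ga : obj D -> G -> C) S : symbols C D :=
  {| F := F S;
     R := fun a b c mu nu => ga a (deg b) * R S a b c mu nu;
     U := fun k a b c mu nu =>
       ga a k * ga b k / ga c k * U S k a b c mu nu;
     eta := fun x g h =>
       ga x (g * h)%g / (ga x g * ga (act g^-1 x) h) * eta S x g h |}.

(* I_n(a) = theta_a^n prod_{j < n} eta_a(g, g^j), for a of degree g. *)
Definition defect_invariant S (n : nat) a : C :=
  twist S a ^+ n * \prod_(j < n) eta S a (deg a) (deg a ^+ j)%g.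

End Crossed.

(* Main.v *)
Require Import Defs.
From mathcomp Require Import all_boot all_order all_algebra.
From mathcomp Require Import reals.
From mathcomp Require Import complex.
From mathcomp Require Import ring zify.

Set Implicit Arguments.
Unset Strict Implicit.
Unset Printing Implicit Defensive.

Import Order.TTheory GRing.Theory Num.Theory.
Local Open Scope ring_scope.

(** Index the powers of the defect by the monoid of natural numbers: write
    F(i,j,k), R(i,j), ... for the symbols of a^i, a^j, a^k; every power of the
    degree g of a fixes all of them.  With k = i = 1 the second heptagon reads
    R(1,j+1) = R(1,1) R(1,j) eta_a(g,g^j) F(1,j,1), so that
      R(1,n) = I_n(a) prod_(j<n) F(1,j,1).
    As U_0 = 1, the first heptagon with k = n and i = 1 gives
      R(n,n) = R(1,n)^n prod_(j<n) F(1,n,j) / (F(n,1,j) F(1,j,n)).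
    The pentagon makes F a 3-cocycle on the free monoid N, hence a coboundary,
    and then the F-factors cancel.  Thus I_n(a)^n = R(n,n) = theta_f, without
    any sign ambiguity, and squaring gives the claim. *)

(** * Sums over one-dimensional splitting spaces *)

Lemma eq1_gt0 (m : nat) : m = 1%N -> (0 < m)%N.
Proof. by move->. Qed.

(** Multiplicities equal 1 by a proof, not by computation, so the summand is evaluated at an ordinal
    carrying that proof; its value still reduces to 0. *)
Lemma big_ord_eq1 (V : nmodType) (m : nat) (Hm : m = 1%N) (X : 'I_m -> V) :
  \sum_(i < m) X i = X (Ordinal (eq1_gt0 Hm)).
Proof. by subst m; rewrite big_ord1; congr X; apply: val_inj. Qed.

Lemma big_ord_eq0 (V : nmodType) (m : nat) (X : 'I_m -> V) :
  m = 0%N -> \sum_(i < m) X i = 0.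
Proof. by move=> m0; rewrite big1 // => -[i Hi]; exfalso; rewrite m0 in Hi. Qed.

Lemma sum_nat_eq1 (T : eqType) (s : seq T) (X : T -> nat) (c : T) :
  c \in s -> uniq s -> (\sum_(e <- s) (e == c) * X e)%N = X c.
Proof.
move=> cs us; rewrite (bigD1_seq c) //= eqxx mul1n big1 ?addn0 // => e.
by move=> /negPf ->.
Qed.

Lemma unitary_block1 (C : numClosedFieldType) (m : nat) (M : nat -> nat -> C) :
  m = 1%N -> unitary_block m M -> M 0 0 * (M 0 0)^* = 1.
Proof.
move=> -> /unitarymxP /matrixP /(_ 0 0).
by rewrite !mxE big_ord_recl big_ord0 addr0 !mxE.
Qed.

(** * Normalized 3-cocycles on the additive monoid of natural numbers *)

Section Coboundary.
Variables (K : fieldType) (F : nat -> nat -> nat -> K).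
Hypothesis F_neq0 : forall i j k, F i j k != 0.
Hypothesis F_0l : forall j k, F 0 j k = 1.
Hypothesis F_0r : forall i j, F i j 0 = 1.
Hypothesis F_pentagon : forall i j k l,
  F (i + j) k l * F i j (k + l) = F i j k * F i (j + k) l * F j k l.

(* Normalized by b 1 k = 1, the primitive of F is forced by F 1 j k. *)
Let b j k : K := \prod_(m < j) (F 1 m k)^-1.

Let b_neq0 j k : b j k != 0.
Proof. by apply/prodf_neq0 => m _; rewrite invr_eq0. Qed.

Let bS j k : b j.+1 k = b j k / F 1 j k.
Proof. by rewrite /b big_ord_recr. Qed.

Let b0 k : b 0 k = 1.
Proof. by rewrite /b big_ord0. Qed.

Let b_0r j : b j 0 = 1.
Proof. by rewrite /b big1 // => m _; rewrite F_0r invr1. Qed.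

(** The pentagon at [1 i j k] expresses [F i.+1 j k] through [F i j k] and values of [F 1], and
    these values are exactly the quotients of successive [b]. *)
Let F_coboundary i j k : F i j k = b j k * b i (j + k) / (b (i + j) k * b i j).
Proof.
elim: i => [|i IHi].
  by rewrite F_0l !b0 add0n !mulr1 divff.
have := F_pentagon 1 i j k; rewrite add1n => pent.
rewrite addSn !bS.
apply: (mulIf (F_neq0 1 i (j + k))); rewrite pent IHi.
field.
by rewrite ?F_neq0 ?b_neq0.
Qed.

(** Once [F] is written through [b], both products telescope. *)
Lemma cocycle_power_product n :
  (\prod_(j < n) F 1 j 1) ^+ n
    * \prod_(j < n) (F 1 n j / (F n 1 j * F 1 j n)) = 1.
Proof.
have E1 m : \prod_(j < m) F 1 j 1 = b 1 m / b m 1.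
  elim: m => [|m IHm]; first by rewrite big_ord0 b_0r b0 divr1.
  rewrite big_ord_recr /= IHm F_coboundary addn1 add1n; field.
  by rewrite !b_neq0.
(* The number of factors [m] is separated from [n] for the induction; at [m = n] the last quotient
   is 1 and the power is inverse to that of [E1]. *)
have E2 m : \prod_(j < m) (F 1 n j / (F n 1 j * F 1 j n))
    = (b n 1 / b 1 n) ^+ m * (b m n / b n m).
  elim: m => [|m IHm]; first by rewrite big_ord0 b_0r b0 expr0 divr1 mulr1.
  rewrite big_ord_recr /= IHm exprSr !F_coboundary.
  rewrite add1n (addn1 n) (add1n m) (addnC m n); field.
  by rewrite ?b_neq0.
rewrite E1 E2 mulrA -exprMn divff ?b_neq0 // mulr1.
by rewrite mulrA divfK ?b_neq0 // divff ?b_neq0 // expr1n.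
Qed.

End Coboundary.

(** * Fusion with objects of quantum dimension 1 *)

Section AbelianFusion.
Context {C : numClosedFieldType} {G : groupType} {D : defect_fusion G}.
Variable S : symbols C D.
Hypothesis SC : crossed_btc S.
Implicit Types (h : G) (a b c d : obj D).

Let FA := crossed_fusion_axioms SC.
Let FF := crossed_F_axioms SC.

Lemma mem_chan a b c : (c \in chan a b) = (deg c == (deg a * deg b)%g).
Proof. exact: mem_sector. Qed.

Lemma chan_uniq a b : uniq (chan a b).
Proof. exact: sector_uniq. Qed.

Lemma fusion_in_chan a b c : (0 < N a b c)%N -> c \in chan a b.
Proof. by move=> /(deg_fusion FA) /eqP; rewrite mem_chan. Qed.

Lemma sum_chan (V : nmodType) a b c (X : obj D -> V) :
    (forall d, N a b d = (d == c)) ->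
  (forall d, N a b d = 0%N -> X d = 0) -> \sum_(d <- chan a b) X d = X c.
Proof.
move=> Nc X0; have cc : c \in chan a b.
  by apply: fusion_in_chan; rewrite Nc eqxx.
rewrite (bigD1_seq c) ?chan_uniq //= big1 ?addr0 // => d dc.
by apply: X0; rewrite Nc (negPf dc).
Qed.

Lemma fuseP a b c : (forall d, N a b d = (d == c)) -> fuse a b = c.
Proof.
move=> Nc; have: c \in [seq d <- chan a b | (0 < N a b d)%N].
  by rewrite mem_filter Nc eqxx fusion_in_chan // Nc eqxx.
rewrite /fuse.
case E: [seq d <- chan a b | _] => [//|e s] _ /=.
have: e \in e :: s by rewrite mem_head.
by rewrite -E mem_filter Nc; case: eqP.
Qed.

Lemma dualK a : dual (dual a) = a.
Proof.
apply/esym/eqP; have := dual_fusionl FA (dual a) a.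
by rewrite (dual_fusionr FA) eqxx; case: eqP.
Qed.

Lemma dual_vac : dual (vac : obj D) = vac.
Proof.
apply/esym/eqP; have := dual_fusionl FA vac vac.
by rewrite (vac_fusionl FA) eqxx; case: eqP.
Qed.

Lemma qdim_gt0 a : 0 < qdim S a.
Proof. by rewrite invr_gt0 normr_gt0 (F_rigid FF). Qed.

Lemma qdim_vac : qdim S vac = 1.
Proof.
have p : (0 < N (vac : obj D) vac vac)%N by rewrite (vac_fusionl FA) eqxx.
have := F_vac1 FF (Ordinal p) (Ordinal p).
by rewrite /qdim dual_vac eqxx /= => ->; rewrite normr1 invr1.
Qed.

Lemma abelian_dual a : abelian S a -> abelian S (dual a).
Proof. by rewrite /abelian (qdim_dual FF). Qed.

Lemma abelian_vac : abelian S vac.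
Proof. exact: qdim_vac. Qed.

(** Dimension count: the vacuum already exhausts the product of dimensions, which is 1, and all
    dimensions are positive, so no other channel has room. *)
Lemma abelian_fuse_dual a c : abelian S a -> N a (dual a) c = (c == vac).
Proof.
move=> aa; have := qdim_fusion FF a (dual a).
rewrite (qdim_dual FF) aa mul1r.
have N1 : N a (dual a) vac = 1%N by rewrite (dual_fusionl FA) eqxx.
have vin : vac \in chan a (dual a) by apply: fusion_in_chan; rewrite N1.
rewrite (bigD1_seq vac) ?chan_uniq //= N1 mul1r qdim_vac.
rewrite -[LHS]addr0 => /addrI /esym /eqP.
rewrite psumr_eq0; last first.
  by move=> d _; rewrite mulr_ge0 ?ler0n ?ltW ?qdim_gt0.
move=> /allP all0; case: (eqVneq c vac) => [->|cv]; first by rewrite N1.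
apply/eqP; rewrite -leqn0 leqNgt; apply/negP => Npos.
have /implyP/(_ cv) := all0 c (fusion_in_chan Npos).
by rewrite mulf_eq0 pnatr_eq0 (gt_eqF (qdim_gt0 c)) orbF -leqn0 leqNgt Npos.
Qed.

Lemma abelian_dual_fuse a c : abelian S a -> N (dual a) a c = (c == vac).
Proof.
by move=> /abelian_dual /(abelian_fuse_dual c); rewrite dualK.
Qed.

(** Otherwise the positive product of the dimensions would be an empty sum. *)
Lemma exists_channel a b : exists c, (0 < N a b c)%N.
Proof.
have /hasP[c _ Nc] : has (fun c => 0 < N a b c)%N (chan a b); last by exists c.
apply/negPn/negP => /hasPn N0.
have := mulr_gt0 (qdim_gt0 a) (qdim_gt0 b).
rewrite (qdim_fusion FF) big_seq big1 ?ltxx // => c /N0.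
by rewrite -leqNgt leqn0 => /eqP ->; rewrite mul0r.
Qed.

(** Reassociating puts [dual a] next to [a], where they fuse to the vacuum only. *)
Lemma sum_dual_fusion a b d : abelian S a ->
  (\sum_(f <- chan a b) N a b f * N (dual a) f d)%N = (d == b).
Proof.
move=> aa; rewrite -(fusion_assoc FA).
rewrite (eq_bigr (fun e => (e == vac) * N e b d)%N); last first.
  by move=> e _; rewrite abelian_dual_fuse.
rewrite sum_nat_eq1 ?chan_uniq ?(vac_fusionl FA) 1?eq_sym //.
by apply: fusion_in_chan; rewrite abelian_dual_fuse ?eqxx.
Qed.

Lemma fusion_dual a b c : abelian S a -> (0 < N a b c)%N ->
  forall d, (0 < N (dual a) c d)%N = (d == b).
Proof.
move=> aa Nc.
have imp d : (0 < N (dual a) c d)%N -> d = b.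
  move=> Nd; apply/eqP; rewrite -[_ == b]lt0b -(sum_dual_fusion b d aa).
  rewrite (bigD1_seq c) ?chan_uniq ?fusion_in_chan //=.
  by rewrite ltn_addr // muln_gt0 Nc.
move=> d; apply/idP/eqP => [/imp //|->].
by have [d' Nd'] := exists_channel (dual a) c; rewrite -(imp _ Nd').
Qed.

(** Every channel of [a] and [b] returns to [b] under fusion with [dual a]. A second channel, or a
    multiplicity above 1, would make [b] occur more than once there, against [sum_dual_fusion]. *)
Lemma abelian_fusion a b : abelian S a -> forall d, N a b d = (d == fuse a b).
Proof.
move=> aa; have [c Nc] := exists_channel a b.
have Nd d : N a b d = (d == c).
  have : (\sum_(f <- chan a b) N a b f * N (dual a) f b)%N = 1%N.
    by rewrite sum_dual_fusion // eqxx.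
  rewrite (bigD1_seq c) ?chan_uniq ?fusion_in_chan //=.
  have Nac : (0 < N (dual a) c b)%N by rewrite (fusion_dual aa Nc).
  case: (eqVneq d c) => [-> | dc] E.
    apply/eqP; rewrite eqn_leq Nc andbT -[nat_of_bool _]/1%N.
    apply: leq_trans (leq_pmulr _ Nac) _.
    by rewrite -E leq_addr.
  apply/eqP; rewrite -leqn0 leqNgt; apply/negP => Npos.
  have Nad : (0 < N (dual a) d b)%N by rewrite (fusion_dual aa Npos).
  have p1 : (0 < N a b c * N (dual a) c b)%N by rewrite muln_gt0 Nc.
  have p2 : (0 < N a b d * N (dual a) d b)%N by rewrite muln_gt0 Npos.
  move: E p1 p2; rewrite big_mkcond /=.
  rewrite (bigD1_seq d) ?chan_uniq ?fusion_in_chan //= dc.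
  lia.
by rewrite (fuseP Nd).
Qed.

Lemma deg_fuse a b : abelian S a -> deg (fuse a b) = (deg a * deg b)%g.
Proof. by move=> aa; apply: (deg_fusion FA); rewrite abelian_fusion // eqxx. Qed.

Lemma abelian_fuse a b : abelian S a -> abelian S b -> abelian S (fuse a b).
Proof.
move=> aa ab; have := qdim_fusion FF a b.
rewrite (sum_chan (abelian_fusion _ aa)); last by move=> d ->; rewrite mul0r.
by rewrite abelian_fusion // eqxx mul1r [qdim S a]aa [qdim S b]ab mulr1.
Qed.

Lemma dual_fuseK a b : abelian S a -> fuse (dual a) (fuse a b) = b.
Proof.
move=> aa; apply: fuseP => d; rewrite -(sum_dual_fusion _ _ aa).
rewrite (eq_bigr (fun e => (e == fuse a b) * N (dual a) e d)%N); last first.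
  by move=> e _; rewrite abelian_fusion.
by rewrite sum_nat_eq1 ?chan_uniq // fusion_in_chan // abelian_fusion ?eqxx.
Qed.

Lemma fuse_inj a : abelian S a -> injective (fuse a).
Proof. by move=> aa b c E; rewrite -(dual_fuseK b aa) E dual_fuseK. Qed.

Lemma fuse_vacl b : fuse vac b = b.
Proof. by apply: fuseP => d; rewrite (vac_fusionl FA) eq_sym. Qed.

Lemma fuse_vacr a : fuse a vac = a.
Proof. by apply: fuseP => d; rewrite (vac_fusionr FA) eq_sym. Qed.

Lemma fuseA a b c : abelian S a -> abelian S b ->
  fuse (fuse a b) c = fuse a (fuse b c).
Proof.
move=> aa ab; apply: fuseP => d.
have := fusion_assoc FA a b c d.
rewrite (eq_bigr (fun e => (e == fuse a b) * N e c d)%N); last first.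
  by move=> e _; rewrite abelian_fusion.
rewrite sum_nat_eq1 ?chan_uniq //; last first.
  by rewrite fusion_in_chan // abelian_fusion ?eqxx.
rewrite (eq_bigr (fun e => (e == fuse b c) * N a e d)%N); last first.
  by move=> e _; rewrite abelian_fusion.
rewrite sum_nat_eq1 ?chan_uniq //; last first.
  by rewrite fusion_in_chan // abelian_fusion ?eqxx.
by move=> ->; rewrite abelian_fusion.
Qed.

Lemma act_fuse h a b : abelian S a -> act h (fuse a b) = fuse (act h a) (act h b).
Proof.
move=> aa; apply/esym/fuseP => d.
have -> : d = act h (act h^-1%g d) by rewrite -(actM FA) mulgV (act1 FA).
rewrite (act_fusion FA) abelian_fusion //.
have actK : cancel (@act _ D h) (act h^-1%g).
  by move=> x; rewrite -(actM FA) mulVg (act1 FA).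
by rewrite (inj_eq (can_inj actK)).
Qed.

(** The crossed braiding of [a] with itself shows that [a] and its translate have the same product
    with [a]; then [a] is cancelled. *)
Lemma act_self a : abelian S a -> act (deg a)^-1%g a = a.
Proof.
move=> aa; apply: (fuse_inj aa); apply: fuseP => d.
by rewrite -(crossed_fusion FA) abelian_fusion.
Qed.

(** * Fusion powers of an abelian defect *)

Lemma fuse_powSr a n : fuse_pow a n.+1 = fuse (fuse_pow a n) a.
Proof. by []. Qed.

Lemma fuse_pow1 a : fuse_pow a 1 = a.
Proof. by rewrite fuse_powSr fuse_vacl. Qed.

Lemma abelian_fuse_pow a n : abelian S a -> abelian S (fuse_pow a n).
Proof.
by move=> aa; elim: n => [|n IHn]; [apply: abelian_vac | apply: abelian_fuse].
Qed.

Lemma deg_fuse_pow a n : abelian S a -> deg (fuse_pow a n) = (deg a ^+ n)%g.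
Proof.
move=> aa; elim: n => [|n IHn]; first by rewrite (deg_vac FA).
by rewrite fuse_powSr deg_fuse ?IHn ?expgSr //; apply: abelian_fuse_pow.
Qed.

Lemma fuse_powD a m n : abelian S a ->
  fuse (fuse_pow a m) (fuse_pow a n) = fuse_pow a (m + n).
Proof.
move=> aa; elim: n => [|n IHn]; first by rewrite addn0 fuse_vacr.
by rewrite addnS !fuse_powSr -fuseA ?IHn //; apply: abelian_fuse_pow.
Qed.

Lemma act_fuse_pow h a n : abelian S a -> act h a = a ->
  act h (fuse_pow a n) = fuse_pow a n.
Proof.
move=> aa ha; elim: n => [|n IHn]; first exact: (act_vac FA).
by rewrite fuse_powSr act_fuse ?IHn ?ha //; apply: abelian_fuse_pow.
Qed.

Lemma act_deg_pow a m n : abelian S a ->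
  act (deg a ^+ m)^-1%g (fuse_pow a n) = fuse_pow a n.
Proof.
move=> aa; apply: act_fuse_pow => //; elim: m => [|m IHm].
  by rewrite invg1 (act1 FA).
by rewrite expgS invgM (actM FA) act_self.
Qed.

Lemma twist_abelian a : abelian S a -> twist S a = Rab S a a.
Proof.
move=> aa; rewrite /twist (sum_chan (abelian_fusion _ aa)); last first.
  by move=> d N0; rewrite big_ord_eq0.
have N1 : N a a (fuse a a) = 1%N by rewrite abelian_fusion ?eqxx.
by rewrite (big_ord_eq1 N1) /= (abelian_fuse aa aa) aa divr1 mul1r.
Qed.

(** * Scalar consistency equations on the powers of the defect *)

Section Powers.
Variable a : obj D.
Hypothesis aa : abelian S a.

Local Notation x := (fuse_pow a).
Local Notation g := (deg a).

Definition Fpow i j k : C :=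
  F S (x i) (x j) (x k) (x (i + j + k)) (x (i + j)) 0 0 (x (j + k)) 0 0.
Definition Rpow i j : C := R S (x i) (x j) (x (i + j)) 0 0.
Definition Upow k i j : C := U S (g ^+ k)%g (x i) (x j) (x (i + j)) 0 0.
Definition etapow i j k : C := eta S (x i) (g ^+ j)%g (g ^+ k)%g.

(** The axioms spell one exponent in several ways; this and the next two lemmas leave only linear
    arithmetic to check. *)
Let FpowE i j k (d e f : nat) :
  d = (i + j + k)%N -> e = (i + j)%N -> f = (j + k)%N ->
  F S (x i) (x j) (x k) (x d) (x e) 0 0 (x f) 0 0 = Fpow i j k.
Proof. by move=> -> -> ->. Qed.

Let RpowE i j m : m = (i + j)%N -> R S (x i) (x j) (x m) 0 0 = Rpow i j.
Proof. by move->. Qed.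

Let UpowE k i j m : m = (i + j)%N ->
  U S (g ^+ k)%g (x i) (x j) (x m) 0 0 = Upow k i j.
Proof. by move->. Qed.

Let fusion_pow i j d : N (x i) (x j) d = (d == x (i + j)).
Proof.
by rewrite -(fuse_powD _ _ aa) abelian_fusion //; apply: abelian_fuse_pow.
Qed.

Let fusion_pow1 i j m : m = (i + j)%N -> N (x i) (x j) (x m) = 1%N.
Proof. by move->; rewrite fusion_pow eqxx. Qed.

Let fusion_pow_gt0 i j m : m = (i + j)%N -> (0 < N (x i) (x j) (x m))%N.
Proof. by move/fusion_pow1 ->. Qed.

Let act_pow m i : act (deg (x m))^-1%g (x i) = x i.
Proof. by rewrite deg_fuse_pow // act_deg_pow. Qed.

Lemma Rpow_unit i j : Rpow i j * (Rpow i j)^* = 1.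
Proof.
apply: (unitary_block1 (fusion_pow1 (erefl (i + j)%N))).
exact: (R_unitary (crossed_crossing_axioms SC)).
Qed.

Lemma Rpow_neq0 i j : Rpow i j != 0.
Proof.
by apply: contra_eq_neq (Rpow_unit i j) => ->; rewrite mul0r eq_sym oner_eq0.
Qed.

Lemma Rpow_conj i j : (Rpow i j)^* = (Rpow i j)^-1.
Proof. by apply: (mulfI (Rpow_neq0 i j)); rewrite Rpow_unit divff ?Rpow_neq0. Qed.

Lemma Fpow_neq0 i j k : Fpow i j k != 0.
Proof.
have cc : x (i + j) \in chan (x i) (x j) by rewrite fusion_in_chan ?fusion_pow_gt0.
have p1 := fusion_pow_gt0 (erefl (i + j)%N).
have p2 := fusion_pow_gt0 (erefl (i + j + k)%N).
have := F_unitaryl FF cc cc (Ordinal p1) (Ordinal p2) (Ordinal p1) (Ordinal p2).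
rewrite !eqxx (sum_chan (fusion_pow j k)); last by move=> d N0; rewrite big_ord_eq0.
rewrite (big_ord_eq1 (fusion_pow1 (erefl (j + k)%N))).
rewrite (big_ord_eq1 (fusion_pow1 (esym (addnA i j k)))) /= FpowE //.
by apply: contra_eq_neq => ->; rewrite mul0r eq_sym oner_eq0.
Qed.

Lemma Fpow_0l j k : Fpow 0 j k = 1.
Proof.
have p := fusion_pow_gt0 (erefl (j + k)%N).
have := F_vac1 FF (Ordinal p) (Ordinal p).
by rewrite eqxx /=.
Qed.

Lemma Fpow_0m i k : Fpow i 0 k = 1.
Proof.
have p := fusion_pow_gt0 (erefl (i + k)%N).
have := F_vac2 FF (Ordinal p) (Ordinal p).
by rewrite eqxx /= /Fpow addn0 add0n.
Qed.

Lemma Fpow_0r i j : Fpow i j 0 = 1.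
Proof.
have p := fusion_pow_gt0 (erefl (i + j)%N).
have := F_vac3 FF (Ordinal p) (Ordinal p).
by rewrite eqxx /= /Fpow !addn0.
Qed.

(** All splitting spaces between powers are one-dimensional, so each sum in the categorical pentagon
    has a single term. *)
Lemma Fpow_pentagon i j k l :
  Fpow (i + j) k l * Fpow i j (k + l)
  = Fpow i j k * Fpow i (j + k) l * Fpow j k l.
Proof.
have p1 := fusion_pow_gt0 (erefl (i + j)%N).
have p2 := fusion_pow_gt0 (erefl (i + j + k)%N).
have p3 := fusion_pow_gt0 (erefl (i + j + k + l)%N).
have p4 := fusion_pow_gt0 (erefl (k + l)%N).
have p5 := fusion_pow_gt0 (erefl (j + (k + l))%N).
have p6 : (0 < N (x i) (x (j + (k + l))) (x (i + j + k + l)))%N.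
  by apply: fusion_pow_gt0; lia.
have := F_pentagon FF (Ordinal p1) (Ordinal p2) (Ordinal p3)
                      (Ordinal p4) (Ordinal p5) (Ordinal p6).
have e1 : (i + j + k + l = i + j + (k + l))%N by lia.
have e2 : (i + j + k = i + (j + k))%N by lia.
have e3 : (j + (k + l) = j + k + l)%N by lia.
rewrite (big_ord_eq1 (fusion_pow1 e1)).
rewrite (sum_chan (fusion_pow j k)); last by move=> d N0; rewrite big_ord_eq0.
rewrite (big_ord_eq1 (fusion_pow1 (erefl (j + k)%N))).
rewrite (big_ord_eq1 (fusion_pow1 e2)).
rewrite (big_ord_eq1 (fusion_pow1 e3)) /=.
by rewrite !FpowE //; lia.
Qed.

Lemma Rpow_heptagon1 i j k :
  Rpow i k * Fpow i k j * Rpow j k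
  = Fpow k i j * Upow k i j * Rpow (i + j) k * Fpow i j k.
Proof.
have p1 : (0 < N (x k) (act (deg (x k))^-1 (x i)) (x (i + k)))%N.
  by rewrite act_pow fusion_pow_gt0 // addnC.
have p2 : (0 < N (x (i + k)) (act (deg (x k))^-1 (x j)) (x (i + j + k)))%N.
  by rewrite act_pow fusion_pow_gt0 //; lia.
have p3 := fusion_pow_gt0 (erefl (j + k)%N).
have p4 := fusion_pow_gt0 (esym (addnA i j k)).
have := heptagon1 (crossed_crossing_axioms SC)
  (Ordinal p1) (Ordinal p2) (Ordinal p3) (Ordinal p4).
rewrite (sum_chan (fusion_pow i j)); last first.
  by move=> d N0; rewrite big_ord_eq0 // (act_fusion FA).
(* Simplification first turns the chosen vertices into 0, dropping the proofs that mention
   translated objects; only then can the translations be removed. *)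
rewrite /= !act_pow.
have e1 : (i + j = i + j)%N by [].
have e2 : (i + j + k = k + (i + j))%N by lia.
rewrite (big_ord_eq1 (fusion_pow1 (erefl (i + k)%N))).
rewrite (big_ord_eq1 (fusion_pow1 (addnC j k))).
rewrite (big_ord_eq1 (fusion_pow1 e1)) (big_ord_eq1 (fusion_pow1 e2)).
rewrite (big_ord_eq1 (fusion_pow1 e1)).
rewrite (big_ord_eq1 (fusion_pow1 (erefl (i + j + k)%N))) /= deg_fuse_pow //.
by rewrite UpowE // !FpowE ?RpowE //; lia.
Qed.

Lemma Rpow_heptagon2 i j k :
  (Rpow k i)^-1 * Fpow i k j * (Rpow k j)^-1
  = Fpow k i j * etapow k i j * (Rpow k (i + j))^-1 * Fpow i j k.
Proof.
set c := x k.
have c1E : act (deg (x i))^-1%g c = c by exact: act_pow.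
have c2E : act (deg (x j))^-1%g (act (deg (x i))^-1%g c) = c by rewrite !act_pow.
have p1 : (0 < N c (x i) (x (i + k)))%N by rewrite fusion_pow_gt0 // addnC.
have p2 : (0 < N (x (i + k)) (x j) (x (i + j + k)))%N.
  by rewrite fusion_pow_gt0 //; lia.
have p3 : (0 < N (x j) (act (deg (x j))^-1 (act (deg (x i))^-1 c)) (x (j + k)))%N.
  by rewrite c2E fusion_pow_gt0.
have p4 := fusion_pow_gt0 (esym (addnA i j k)).
have := heptagon2 (crossed_crossing_axioms SC)
  (Ordinal p1) (Ordinal p2) (Ordinal p3) (Ordinal p4).
rewrite (sum_chan (fusion_pow i j)); last first.
  by move=> d N0; rewrite big_ord_eq0.
rewrite /= c2E c1E /c.
have e2 : (i + j + k = k + (i + j))%N by lia.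
rewrite (big_ord_eq1 (fusion_pow1 (erefl (i + k)%N))).
rewrite (big_ord_eq1 (fusion_pow1 (addnC j k))).
rewrite (big_ord_eq1 (fusion_pow1 (erefl (i + j)%N))) (big_ord_eq1 (fusion_pow1 e2)).
rewrite (big_ord_eq1 (fusion_pow1 (erefl (i + j + k)%N))) /= !deg_fuse_pow //.
by rewrite !RpowE ?Rpow_conj ?FpowE //; lia.
Qed.

(** With two vacuum strands the heptagon says that the inverse of [Rpow i 0] equals its own
    square. *)
Lemma Rpow_0r i : Rpow i 0 = 1.
Proof.
have := Rpow_heptagon2 0 0 i.
rewrite Fpow_0l Fpow_0r !Fpow_0m /etapow (eta_1l (crossed_action_axioms SC)).
rewrite !mulr1 mul1r addn0 => /(congr1 (fun z => Rpow i 0 * Rpow i 0 * z)).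
have := Rpow_neq0 i 0 => Ri0.
by rewrite mulrACA mulfK // !divff // mulr1.
Qed.

Lemma Rpow_1S n : Rpow 1 n.+1 = Rpow 1 1 * Rpow 1 n * etapow 1 1 n * Fpow 1 n 1.
Proof.
have := Rpow_heptagon2 1 n 1; rewrite add1n.
set u := Rpow 1 1; set v := Rpow 1 n; set w := Rpow 1 _; set f := Fpow 1 1 n.
have [u0 v0 w0 f0] : [/\ u != 0, v != 0, w != 0 & f != 0].
  by rewrite !Rpow_neq0 Fpow_neq0.
(* The middle term is the left side of [E] times the factor that turns it into [w]; the common [f]
   of the two sides of [E] then cancels. *)
move=> E; transitivity (u^-1 * f * v^-1 * (w * u * v / f)).
  by field; rewrite ?u0 ?v0 ?w0 ?f0.
by rewrite E; field; rewrite ?u0 ?v0 ?w0 ?f0.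
Qed.

Lemma Rpow_1n n :
  Rpow 1 n = Rpow 1 1 ^+ n * \prod_(j < n) etapow 1 1 j * \prod_(j < n) Fpow 1 j 1.
Proof.
elim: n => [|n IHn]; first by rewrite !big_ord0 Rpow_0r expr0 !mulr1.
by rewrite Rpow_1S !big_ord_recr /= exprS IHn; ring.
Qed.

Lemma Upow_eq1 n i j : (g ^+ n)%g = 1%g -> Upow n i j = 1.
Proof.
move=> gn; rewrite /Upow gn.
have p := fusion_pow_gt0 (erefl (i + j)%N).
have := U_1 (crossed_action_axioms SC) (Ordinal p) (Ordinal p).
by rewrite eqxx.
Qed.

(** Only the second strand must have trivial degree, since that degree indexes [U]. The first
    exponent stays free for the induction, whose step is the heptagon at [1 m n]. *)
Lemma Rpow_mn n m : (g ^+ n)%g = 1%g ->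
  Rpow m n = Rpow 1 n ^+ m * \prod_(j < m) (Fpow 1 n j / (Fpow n 1 j * Fpow 1 j n)).
Proof.
move=> gn; elim: m => [|m IHm].
  have := Rpow_heptagon1 0 0 n.
  rewrite !Fpow_0l Fpow_0r Upow_eq1 // big_ord0 expr0 !mulr1 !mul1r addn0.
  by rewrite -[RHS]mulr1 => /(mulfI (Rpow_neq0 0 n)).
have := Rpow_heptagon1 1 m n; rewrite Upow_eq1 // mulr1 add1n => E.
have F1 := Fpow_neq0 n 1 m; have F2 := Fpow_neq0 1 m n.
rewrite big_ord_recr exprSr /= mulrACA -IHm.
apply: (mulfI F1); apply: (mulIf F2); rewrite -E.
by field; rewrite ?F1 ?F2.
Qed.

Lemma Rpow_nn n : (g ^+ n)%g = 1%g ->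
  Rpow n n = (Rpow 1 1 ^+ n * \prod_(j < n) etapow 1 1 j) ^+ n.
Proof.
move=> gn; rewrite (Rpow_mn n gn) Rpow_1n exprMn -mulrA.
rewrite (cocycle_power_product Fpow_neq0 Fpow_0l Fpow_0r Fpow_pentagon).
by rewrite mulr1.
Qed.

Lemma twist_fuse_pow n : twist S (x n) = Rpow n n.
Proof.
have axn : abelian S (x n) by apply: abelian_fuse_pow.
by rewrite (twist_abelian axn) /Rab (fuse_powD _ _ aa).
Qed.

Lemma defect_invariant_root n : (g ^+ n)%g = 1%g ->
  defect_invariant S n a ^+ n = twist S (x n).
Proof.
move=> gn; rewrite twist_fuse_pow Rpow_nn // /defect_invariant.
(* [Rpow 1 1] is the twist of the first power, which is [a] itself. *)
by rewrite -twist_fuse_pow /etapow !fuse_pow1 expg1.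
Qed.

End Powers.

(** * Gauge invariance *)

Lemma defect_invariant_symmetry (ga : obj D -> G -> C) a n :
    symmetry_gauge ga -> abelian S a -> (deg a ^+ n)%g = 1%g ->
  defect_invariant (symmetry_transform ga S) n a = defect_invariant S n a.
Proof.
move=> Hga aa gn; set g := deg a.
have ga0 k : ga a k != 0.
  by rewrite -normr_gt0 (symmetry_gauge_phase Hga) ltr01.
have tw : twist (symmetry_transform ga S) a = ga a g * twist S a.
  rewrite /twist mulr_sumr; apply: eq_bigr => c _.
  by rewrite mulr_sumr; apply: eq_bigr => mu _ /=; rewrite mulrCA.
(* As [a] is fixed by its own degree, numerator and denominator cancel between neighbours. At
   [m = n] the surviving [ga a 1] is 1, and the power of [ga a g] cancels the change of the
   twist. *)
have telescope m : \prod_(j < m) eta (symmetry_transform ga S) a g (g ^+ j)%g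
    = ga a (g ^+ m)%g / ga a g ^+ m * \prod_(j < m) eta S a g (g ^+ j)%g.
  elim: m => [|m IHm].
    by rewrite !big_ord0 expg0 (symmetry_gauge_1 Hga) divr1 mulr1.
  rewrite !big_ord_recr /= IHm act_self // -expgS exprS; field.
  by rewrite !ga0 /= expf_neq0.
rewrite /defect_invariant -/g tw telescope gn (symmetry_gauge_1 Hga) exprMn.
by field; rewrite expf_neq0.
Qed.

(** All four gauge factors are phases, being unitary of size 1, and the dimension sees only the
    modulus of the F-symbol. *)
Lemma qdim_vertex_transform Ga a :
  vertex_gauge Ga -> qdim (vertex_transform Ga S) a = qdim S a.
Proof.
move=> HGa; rewrite /qdim /=.
have N1 : N a (dual a) vac = 1%N by rewrite (dual_fusionl FA) eqxx.
have N2 : N vac a a = 1%N by rewrite (vac_fusionl FA) eqxx.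
have N3 : N (dual a) a vac = 1%N by rewrite (dual_fusionr FA) eqxx.
have N4 : N a vac a = 1%N by rewrite (vac_fusionr FA) eqxx.
rewrite (big_ord_eq1 N1) (big_ord_eq1 N2) (big_ord_eq1 N3) (big_ord_eq1 N4) /=.
have Ga1 b c d : N b c d = 1%N -> `|Ga b c d 0%N 0%N| = 1.
  move=> Nd; have := unitary_block1 Nd (vertex_gauge_unitary HGa b c d).
  by move/eqP; rewrite -normCK sqrp_eq1 ?normr_ge0 // => /eqP.
by rewrite !normrM !norm_conjC !Ga1 // !mul1r !mulr1.
Qed.

(** Since [a] is fixed by its degree, its self-braiding maps a splitting space to itself, and the
    gauge factor meets its own conjugate. *)
Lemma defect_invariant_vertex Ga a n : vertex_gauge Ga -> abelian S a ->
  defect_invariant (vertex_transform Ga S) n a = defect_invariant S n a.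
Proof.
move=> HGa aa; rewrite /defect_invariant /=; congr (_ ^+ n * _).
rewrite /twist; apply: eq_bigr => c _; apply: eq_bigr => -[mu mu_lt] _ /=.
(* The mere existence of the index [mu] rules out multiplicity 0. *)
have N1 : N a a c = 1%N.
  by move: mu_lt; rewrite abelian_fusion //; case: (c == _).
have -> : mu = 0%N by move: mu_lt; rewrite N1; case: mu.
rewrite !qdim_vertex_transform // act_self // !(big_ord_eq1 N1) /=.
congr (_ * _); rewrite mulrAC.
by rewrite (unitary_block1 N1 (vertex_gauge_unitary HGa a a c)) mul1r.
Qed.

End AbelianFusion.

Theorem mainTheorem7 (R : realType) (G : groupType) (D : defect_fusion G)
    (S : symbols R[i] D)
    (S_crossed : crossed_btc S)
    (S_modular : modular_trivial_sector S)
    (G_fixes_anyons : forall (k : G) (x : obj D), deg x = 1%g -> act k x = x)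
    (g : G) (n : nat) (n_ge1 : (1 <= n)%N) (g_pow_n : (g ^+ n)%g = 1%g)
    (a : obj D) (deg_a : deg a = g) (a_abelian : abelian S a) :
  let f := fuse_pow a n in
  [/\ (deg f = 1%g /\ abelian S f),
      (forall Ga, vertex_gauge Ga ->
         defect_invariant (vertex_transform Ga S) n a = defect_invariant S n a),
      (forall ga, symmetry_gauge ga ->
         defect_invariant (symmetry_transform ga S) n a
         = defect_invariant S n a),
      defect_invariant S n a ^+ (2 * n) = twist S f ^+ 2
    & twist S f ^+ 2 = monodromy S f f].
Proof.
move: g_pow_n; rewrite -deg_a => gn f.
have af : abelian S f by apply: abelian_fuse_pow.
split.
- by rewrite (deg_fuse_pow S_crossed).
- by move=> Ga HGa; apply: defect_invariant_vertex.
- by move=> ga Hga; apply: defect_invariant_symmetry.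
- by rewrite mulnC exprM (defect_invariant_root S_crossed).
- by rewrite (twist_abelian S_crossed af) expr2.
Qed.
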